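(* Let $\omega$ be a non-principal ultrafilter on $\mathbb N$ and let $\big((X_i,d_i,\mathfrak m_i,p_i)\big)_{i\in\mathbb N}$ be an $\omega$-uniformly boundedly finite sequence of pointed metric measure spaces, with ultralimit $(X_\omega,d_\omega,\mathfrak m_\omega,p_\omega)$. Then the following conditions are equivalent: i) $\mathfrak m_\omega$ is concentrated on ${\rm spt}(\mathfrak m_\omega)$. ii) $\mathfrak m_\omega$ is concentrated on a closed and separable set $C\subset X_\omega$. iii) The ultralimit is boundedly $\mathfrak m_\omega$-totally bounded: for every $R,r,\varepsilon>0$ there is a finite collection of points $(x_n)_{n=1}^M\subset X_\omega$ such that $\mathfrak m_\omega\big(\bar B(p_\omega,R)\setminus\bigcup_{n=1}^MB(x_n,r)\big)\le\varepsilon$. iv) The sequence is asymptotically boundedly $\mathfrak m_\omega$-totally bounded: for every $R,r,\varepsilon>0$ there exist $M\in\mathbb N$ and points $(x^i_n)_{n=1}^M\subset X_i$ (for each $i$) such that $\lim_{i\to\omega}\mathfrak m_i\big(\bar B(p_i,R)\setminus\bigcup_{n=1}^MB(x^i_n,r)\big)\le\varepsilon$.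
   Context: For a metric space $(X,d)$, $B(x,r)$ and $\bar B(x,r)=\{y:d(x,y)\le r\}$ are the open and closed balls, and ${\rm Ball}(X)$ is the $\sigma$-algebra generated by open balls (it contains every closed separable subset). A metric measure space $(X,d,\mathfrak m)$ is a metric space with a measure $\mathfrak m$ on ${\rm Ball}(X)$; pointed means that a point $p\in X$ is chosen. ${\rm spt}(\mathfrak m):=\{x:\mathfrak m(B(x,r))>0\ \forall r>0\}$; if $\mathfrak m$ is $\sigma$-finite this set is closed, separable and in ${\rm Ball}(X)$. $\mathfrak m$ is concentrated on $A\in{\rm Ball}(X)$ if $\mathfrak m(X\setminus A)=0$. ''For $\omega$-a.e. $i$'' means for all $i$ in some element of $\omega$; $\lim_{i\to\omega}$ is the ultralimit. $\omega$-uniformly boundedly finite: there is $\eta\colon(0,+\infty)\to(0,+\infty)$ such that for every $R>0$, $\mathfrak m_i(B(p_i,R))\le\eta(R)$ for $\omega$-a.e. $i$. Ultralimit $(X_\omega,d_\omega,\mathfrak m_\omega,p_\omega)$. Let $\bar X_\omega$ be the set of families $(x_i)_{i\in S}$, $S\in\omega$, $x_i\in X_i$, modulo equality for $\omega$-a.e. $i$ (classes $[x_i]$); $\bar d_\omega([x_i],[y_i]):=\lim_{i\to\omega}d_i(x_i,y_i)$; $O(\bar X_\omega):=\{[x_i]:\bar d_\omega([x_i],[p_i])<+\infty\}$. $X_\omega$ is the quotient of $O(\bar X_\omega)$ by $\bar d_\omega=0$, with classes $[[x_i]]$, induced distance $d_\omega$, projection $\pi\colon O(\bar X_\omega)\to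 X_\omega$, and $p_\omega:=[[p_i]]$. For $S\in\omega$ and $A_i\in{\rm Ball}(X_i)$, $i\in S$, let $\Pi_{i\to\omega}A_i:=\{[x_i]\in\bar X_\omega:x_i\in A_i\text{ for }\omega\text{-a.e. }i\}$; $\mathcal A_O(\bar X_\omega)$ is the algebra of all sets $(\Pi_{i\to\omega}A_i)\cap O(\bar X_\omega)$, and $\bar{\mathfrak m}_\omega\big((\Pi_{i\to\omega}A_i)\cap O(\bar X_\omega)\big):=\lim_{R\to\infty}\lim_{i\to\omega}\mathfrak m_i(A_i\cap B(p_i,R))$. $N\subset O(\bar X_\omega)$ is null ($N\in\mathcal N_\omega$) if for every $\varepsilon>0$ there is $\bar A\in\mathcal A_O(\bar X_\omega)$ with $N\subset\bar A$, $\bar{\mathfrak m}_\omega(\bar A)<\varepsilon$. $\bar{\mathcal B}_\omega$ is the family of $A\subset O(\bar X_\omega)$ such that for every $R>0$ there is $\bar A_R\in\mathcal A_O(\bar X_\omega)$ with $(A\cap\Pi_{i\to\omega}B(p_i,R))\Delta\bar A_R\in\mathcal N_\omega$; for such $A$, $\bar{\mathfrak m}_\omega(A):=\lim_{R\to\infty}\bar{\mathfrak m}_\omega(\bar A_R)$. Under $\omega$-uniform bounded finiteness, $\bar{\mathcal B}_\omega$ is a $\sigma$-algebra, $\bar{\mathfrak m}_\omega$ is a measure on it, $\pi^{-1}(A)\in\bar{\mathcal B}_\omega$ for all $A\in{\rm Ball}(X_\omega)$, and $\mathfrak m_\omega(A):=\bar{\mathfrak m}_\omega(\pi^{-1}(A))$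 for $A\in{\rm Ball}(X_\omega)$. The measure $\mathfrak m_\omega$ is finite on balls. *)

(* Defs.v *)
From HB Require Import structures.
From mathcomp Require Import all_boot all_order all_algebra generic_quotient.
From mathcomp Require Import all_classical all_reals all_analysis.

Set Implicit Arguments.
Unset Strict Implicit.
Unset Printing Implicit Defensive.

Import Order.TTheory GRing.Theory Num.Theory.
Import numFieldNormedType.Exports.

Local Open Scope classical_set_scope.
Local Open Scope ring_scope.

Section ultralimit_ereal.
Context {R : realType} {w : set_system nat} {U : UltraFilter w}.
Implicit Types u v : nat -> \bar R.
Local Open Scope ereal_scope.

Lemma ulim_cvg u : u i @[i --> w] --> lim (u i @[i --> w]).
Proof.
pose E := [set x | \forall i \near w, x <= u i].
apply: (@cvgP _ _ (ereal_sup E)).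
have lo (a : \bar R) : a < ereal_sup E -> \forall i \near w, a < u i.
  move=> /ereal_sup_gt[x Ex ax]; apply: filterS Ex => i; exact: lt_le_trans.
have hi (b : \bar R) : ereal_sup E < b -> \forall i \near w, u i < b.
  move=> Eb; have [|nb] := in_ultra_setVsetC [set i | b <= u i] U.
    by move=> /(@ereal_sup_ubound _ E b); rewrite leNgt Eb.
  by apply: filterS nb => i /= /negP; rewrite -ltNge.
case: (ereal_sup E) lo hi => [r| |] lo hi A.
- move=> [e /= e0 eA].
  have h1 := lo (r - e)%:E; have h2 := hi (r + e)%:E.
  rewrite lte_fin ltrBlDr ltrDl in h1; rewrite lte_fin ltrDl in h2.
  apply: filterS2 (h1 e0) (h2 e0) => i /=; case: (u i) => // x.
  rewrite !lte_fin => x1 x2; apply: eA => /=.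
  by rewrite distrC ltr_distl x1 x2.
- move=> [M [_ MA]]; apply: filterS (lo M%:E (ltry _)) => i; exact: MA.
- move=> [M [_ MA]]; apply: filterS (hi M%:E (ltNyr _)) => i; exact: MA.
Qed.

Lemma ulim_const (c : \bar R) : lim (c @[_ --> w]) = c.
Proof. by apply/cvg_lim => //; exact: cvg_cst. Qed.

Lemma ulim_ge0 u : (forall i, 0 <= u i) -> 0 <= lim (u i @[i --> w]).
Proof.
by move=> u0; apply: lime_ge; [exact: ulim_cvg|exact: nearW].
Qed.

Lemma ulim_near u v : (\forall i \near w, u i = v i) ->
  lim (u i @[i --> w]) = lim (v i @[i --> w]).
Proof.
move=> uv; apply/cvg_lim => //.
have := @ulim_cvg v; apply: cvg_trans; apply: near_eq_cvg.
by apply: filterS uv => i ->.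
Qed.

End ultralimit_ereal.

(* The base point p of a pointed metric space is [point]. *)
#[short(type="pmetricType")]
HB.structure Definition PMetric (K : numDomainType) :=
  {M of Metric K M & Pointed M}.

Section balls.
Context {R : realType} (X : pmetricType R).

Definition open_balls : set (set X) :=
  [set B | exists x, exists2 r, 0 < r & B = ball x r].

Definition cball (x : X) (r : R) : set X := [set y | mdist x y <= r].

Definition ballType := g_sigma_algebraType open_balls.

Definition Ball : set (set X) := @measurable _ ballType.

Definition separable (C : set X) :=
  exists D : set X, [/\ countable D, D `<=` C & C `<=` closure D].

(* [mu] is only meaningful on Ball(X); it is a bare set function so as to apply
   to the limit measure below, which is defined on all sets. *)
Implicit Type mu : set X -> \bar R.

Definition spt mu : set X :=
  [set x | forall r, 0 < r -> (0 < mu (ball x r))%E].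

Definition concentrated mu (A : set X) := Ball A /\ mu (~` A) = 0%E.

Definition boundedly_totally_bounded mu :=
  forall r0 r e : R, 0 < r0 -> 0 < r -> 0 < e ->
  exists (M : nat) (x : 'I_M -> X),
    (mu (cball point r0 `\` \bigcup_n ball (x n) r) <= e%:E)%E.

End balls.

Section ultralimit_space.
Context {R : realType} (w : set_system nat) {U : UltraFilter w}.
Variable X : nat -> pmetricType R.

Definition ae_eq (x y : forall i, X i) : bool :=
  `[< \forall i \near w, x i = y i >].

Let ae_eq_refl : reflexive ae_eq.
Proof. by move=> x; apply/asboolP; exact: nearW. Qed.

Let ae_eq_sym : symmetric ae_eq.
Proof.
by move=> x y; apply/asboolP/asboolP; apply: filterS => i ->.
Qed.

Let ae_eq_trans : transitive ae_eq.
Proof.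
move=> y x z /asboolP xy /asboolP yz; apply/asboolP.
by apply: filterS2 xy yz => i -> ->.
Qed.

Canonical ae_eq_equiv := EquivRel ae_eq ae_eq_refl ae_eq_sym ae_eq_trans.

(* As every X_i is pointed, any family indexed by some S in w coincides on S
   with a family indexed by nat, hence only the latter are used. *)
Definition ultraproduct := {eq_quot ae_eq}%qT.
HB.instance Definition _ := Choice.on ultraproduct.
HB.instance Definition _ := EqQuotient.on ultraproduct.

Definition uclass (x : forall i, X i) : ultraproduct := (\pi x)%qT.

Definition udist (x y : ultraproduct) : \bar R :=
  lim ((mdist (repr x i) (repr y i))%:E @[i --> w]).

Lemma repr_uclass x : \forall i \near w, repr (uclass x) i = x i.
Proof.
by apply/asboolP; have /eqmodP := reprK (uclass x).
Qed.

Lemma udistE x y :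
  udist (uclass x) (uclass y) = lim ((mdist (x i) (y i))%:E @[i --> w]).
Proof.
apply: ulim_near; apply: filterS2 (repr_uclass x) (repr_uclass y).
by move=> i -> ->.
Qed.

Lemma udist_ge0 x y : (0 <= udist x y)%E.
Proof. by apply: ulim_ge0 => i; rewrite lee_fin mdist_ge0. Qed.

Lemma udistxx x : udist x x = 0%E.
Proof.
rewrite /udist; under eq_fun do rewrite mdistxx.
exact: ulim_const.
Qed.

Lemma udistC x y : udist x y = udist y x.
Proof. by rewrite /udist; under eq_fun do rewrite metric_sym. Qed.

Lemma udist_triangle y x z : (udist x z <= udist x y + udist y z)%E.
Proof.
pose d (a b : ultraproduct) i : \bar R := (mdist (repr a i : X i) (repr b i))%:E.
have D : (udist x y +? udist y z)%E by rewrite ge0_adde_def// inE udist_ge0.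
have xyz := cvgeD (F := w) (f := d x y) (g := d y z) D
  (@ulim_cvg R w U (d x y)) (@ulim_cvg R w U (d y z)).
rewrite -(cvg_lim _ (xyz _))//; apply: lee_lim; first exact: ulim_cvg.
  exact: cvgP (xyz _).
by apply: nearW => i /=; rewrite -EFinD lee_fin metric_triangle.
Qed.

(* the set O of classes at finite distance from [p_i], as a type *)
Definition finpart :=
  {x : ultraproduct | (udist x (uclass (fun=> point)) < +oo)%E}.
HB.instance Definition _ := Choice.on finpart.

Lemma udist_fin (x y : finpart) : udist (val x) (val y) \is a fin_num.
Proof.
rewrite ge0_fin_numE ?udist_ge0//.
apply: le_lt_trans (udist_triangle (uclass (fun=> point)) _ _) _.
by rewrite lte_add_pinfty// ?(valP x)// udistC (valP y).
Qed.

Definition dist0 (x y : finpart) : bool := udist (val x) (val y) == 0%E.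

Let dist0_refl : reflexive dist0.
Proof. by move=> x; rewrite /dist0 udistxx. Qed.

Let dist0_sym : symmetric dist0.
Proof. by move=> x y; rewrite /dist0 udistC. Qed.

Let dist0_trans : transitive dist0.
Proof.
move=> y x z /eqP xy /eqP yz; apply/eqP/le_anti; rewrite udist_ge0 andbT.
by rewrite (le_trans (udist_triangle (val y) _ _))// xy yz adde0.
Qed.

Canonical dist0_equiv := EquivRel dist0 dist0_refl dist0_sym dist0_trans.

Definition ultralimit := {eq_quot dist0}%qT.
HB.instance Definition _ := Choice.on ultralimit.
HB.instance Definition _ := EqQuotient.on ultralimit.

Definition uproj (x : finpart) : ultralimit := (\pi x)%qT.

Definition ulim_dist (a b : ultralimit) : R :=
  fine (udist (val (repr a)) (val (repr b))).

Lemma udist_repr (x : finpart) : udist (val (repr (uproj x))) (val x) = 0%E.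
Proof. by apply/eqP; have /eqmodP := reprK (uproj x). Qed.

Lemma ulim_distE (x y : finpart) :
  ulim_dist (uproj x) (uproj y) = fine (udist (val x) (val y)).
Proof.
congr fine; apply/le_anti/andP; split.
- rewrite (le_trans (udist_triangle (val x) _ _))// udist_repr add0e.
  by rewrite (le_trans (udist_triangle (val y) _ _))// [in leLHS](udistC (val y))
    udist_repr adde0.
- rewrite (le_trans (udist_triangle (val (repr (uproj x))) _ _))//
    udistC udist_repr add0e.
  by rewrite (le_trans (udist_triangle (val (repr (uproj y))) _ _))//
    udist_repr adde0.
Qed.

Let ulim_distxx a : ulim_dist a a = 0.
Proof. by rewrite /ulim_dist udistxx. Qed.

Let ulim_dist_positivity a b : ulim_dist a b = 0 -> a = b.
Proof.
move=> ab; rewrite -(reprK a) -(reprK b); apply/eqmodP/eqP.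
by rewrite -[LHS]fineK ?udist_fin// -[fine _]/(ulim_dist a b) ab.
Qed.

Let ulim_distC a b : ulim_dist a b = ulim_dist b a.
Proof. by rewrite /ulim_dist udistC. Qed.

Let ulim_dist_triangle b a c : ulim_dist a c <= ulim_dist a b + ulim_dist b c.
Proof.
rewrite /ulim_dist -fineD ?udist_fin// fine_le ?fin_numD ?udist_fin//.
exact: udist_triangle.
Qed.

HB.instance Definition _ := @isMetric.Build R ultralimit ulim_dist
  ulim_distxx ulim_dist_positivity ulim_distC ulim_dist_triangle.

Let base_fin : (udist (uclass (fun=> point)) (uclass (fun=> point)) < +oo)%E.
Proof. by rewrite udistxx. Qed.

Definition ubase : finpart := exist _ (uclass (fun=> point)) base_fin.

HB.instance Definition _ := isPointed.Build ultralimit (uproj ubase).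

End ultralimit_space.

Arguments ultraproduct {R} w {U} X.
Arguments finpart {R} w {U} X.
Arguments ultralimit {R} w {U} X.
Arguments uclass {R} w {U X} x.
Arguments uproj {R w U X} x.
Arguments ubase {R} w {U} X.
Arguments repr_uclass {R} w {U X} x.

Section ultralimit_measure.
Context {R : realType} (w : set_system nat) {U : UltraFilter w}.
Variables (X : nat -> pmetricType R).
Variable m : forall i, {measure set (ballType (X i)) -> \bar R}.
Local Open Scope ereal_scope.

Definition unif_boundedly_finite :=
  exists2 eta : R -> R, (forall r, 0 < r -> 0 < eta r)%R &
    forall r, (0 < r)%R -> \forall i \near w, m i (ball point r) <= (eta r)%:E.

(* (Pi_{i -> w} A_i) `&` O; families of sets indexed by some S in w are extended
   by the empty set outside S. *)
Definition internal (A : forall i, set (X i)) : set (finpart w X) :=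
  [set x | \forall i \near w, A i (repr (val x) i)].

Definition ball_families : set (forall i, set (X i)) :=
  [set A | forall i, Ball (A i)].

Definition internal_algebra : set (set (finpart w X)) :=
  [set internal A | A in ball_families].

Definition family_mass (A : forall i, set (X i)) : \bar R :=
  lim (lim (m i (A i `&` ball point r) @[i --> w]) @[r --> +oo%R]).

(* By [internal_massE] the value does not depend on the family chosen. *)
Definition internal_mass (A : set (finpart w X)) : \bar R :=
  family_mass (get [set B | ball_families B /\ internal B = A]).

Lemma internal_massE (A : forall i, set (X i)) :
  ball_families A -> internal_mass (internal A) = family_mass A.
Proof.
move=> mA; rewrite /internal_mass.
have [] := @getI _ [set B | ball_families B /\ internal B = internal A] A.
  by split.
move: (get _) => B mB AB.
suff E (r : R) : lim (m i (B i `&` ball point r) @[i --> w]) =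
    lim (m i (A i `&` ball point r) @[i --> w]).
  by rewrite /family_mass; under eq_fun do rewrite E.
apply: ulim_near.
suff sub (C D : forall i, set (X i)) : internal C `<=` internal D ->
    \forall i \near w, C i `&` ball point r `<=` D i `&` ball point r.
  have h1 := @sub A B; have h2 := @sub B A; rewrite AB in h1 h2.
  apply: filterS2 (h1 (fun _ => id)) (h2 (fun _ => id)) => i s1 s2.
  by congr (m i _); apply/seteqP.
move=> CD; have [//|nw] := in_ultra_setVsetC
  [set i | C i `&` ball point r `<=` D i `&` ball point r] U.
pose bad i (y : X i) := (C i `&` ball point r) y /\ ~ D i y.
pose x i : X i := get (bad i).
have badx : \forall i \near w, bad i (x i).
  apply: filterS nw => i /= /existsNP[y /not_implyP[[Cy by_] nDy]].
  by apply: (@getPex _ (bad i)); exists y; split => // Dy; apply: nDy.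
have xfin : udist (uclass w x) (uclass w (fun=> point)) < +oo.
  rewrite udistE; apply: (@le_lt_trans _ _ r%:E); last by rewrite ltry.
  apply: lime_le; first exact: ulim_cvg.
  apply: filterS badx => i [[_ +] _].
  by rewrite ballEmdist /= metric_sym lee_fin => /ltW.
have : internal D (exist _ (uclass w x) xfin : finpart w X).
  apply: CD; rewrite /internal /=.
  by apply: filterS2 badx (repr_uclass w x) => i [[? _] _] ->.
rewrite /internal /= => Dx; exfalso; apply: (@filter_not_empty _ w _).
have nDx : w [set i | ~ D i (x i)] by apply: filterS badx => i [].
have rx := @repr_uclass R w U X x.
apply: (@filterS _ w _ _ _ _ (filterI Dx (filterI nDx rx))) => i /= [+ [nDi ri]].
by rewrite ri.
Qed.

Definition null (N : set (finpart w X)) :=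
  forall e : R, (0 < e)%R ->
  exists A, [/\ internal_algebra A, N `<=` A & internal_mass A < e%:E].

Definition truncations (A : set (finpart w X)) (r : R) : set (set (finpart w X)) :=
  [set B | internal_algebra B /\
    null ((A `&` internal (fun=> ball point r)) `+` B)].

Definition loeb_measurable : set (set (finpart w X)) :=
  [set A | forall r : R, (0 < r)%R -> truncations A r !=set0].

(* Meaningful on [loeb_measurable], where the chosen truncations are unique up to
   null sets. *)
Definition loeb_mass (A : set (finpart w X)) : \bar R :=
  lim (internal_mass (get (truncations A r)) @[r --> +oo%R]).

(* Meaningful on Ball(X_w), whose preimages under [uproj] are [loeb_measurable]
   as soon as [unif_boundedly_finite] holds. *)
Definition ulim_mass (A : set (ultralimit w X)) : \bar R :=
  loeb_mass (@uproj _ w _ X @^-1` A).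

Definition asymptotically_boundedly_totally_bounded :=
  forall r0 r e : R, (0 < r0)%R -> (0 < r)%R -> (0 < e)%R ->
  exists (M : nat) (x : forall i, 'I_M -> X i),
    lim (m i (cball point r0 `\` \bigcup_n ball (x i n) r) @[i --> w]) <= e%:E.

End ultralimit_measure.

Arguments ulim_mass {R} w {U X} m A.

(* Main.v *)
(* Loeb's construction. The outer measure of a subset of the finite part O
   is the infimum of the masses of the internal sets covering it. Because
   the ultrafilter is non-principal, internal sets are countably saturated,
   so a single internal cover does as well as a countable one; hence this is
   an outer measure for which internal sets are Caratheodory measurable. By
   bounded finiteness every Caratheodory set is, inside each ball, internal
   up to a null set, so the mass defined by truncations is the Caratheodory
   measure, and m_w is its image under the projection: a measure on
   Ball(X_w), finite on balls.
   For such a measure (i) => (ii) holds as disjoint balls centred in the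
   support have positive mass, so there are countably many in each ball;
   (ii) => (iii) is continuity from above; and (iii) makes the complement of
   the closure of the countable set of all centres null, which together with
   countably many null balls exhausts the complement of the support. Finally
   (iii) <=> (iv) by replacing points of X_w by representatives: centres of
   (iv) at infinite distance from p_w never meet a bounded set. *)
From HB Require Import structures.
Require Import Defs.
From mathcomp Require Import all_boot all_order all_algebra.
From mathcomp Require Import all_classical all_reals all_analysis.

Set Implicit Arguments.
Unset Strict Implicit.
Unset Printing Implicit Defensive.

Import Order.TTheory GRing.Theory Num.Theory.

Local Open Scope classical_set_scope.
Local Open Scope ring_scope.

(** * Countable families of measurable sets *)

Lemma countable_bigcup_measurable d (T : sigmaRingType d) I (D : set I)
    (F : I -> set T) : countable D -> (forall i, D i -> measurable (F i)) ->
  measurable (\bigcup_(i in D) F i).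
Proof.
rewrite -(eq_countable (card_setT _)) => cD mF; rewrite bigcup_set_type.
by apply: countable_bigcupT_measurable => // i; apply: mF; exact: set_valP.
Qed.

(** An injection [f] of [D] into the naturals groups the union by the values of [f], and each group
    holds at most one set. *)
Lemma countable_bigcup_negligible d (T : sigmaRingType d) (R : realFieldType)
    (mu : {measure set T -> \bar R}) I (D : set I) (F : I -> set T) :
  countable D -> (forall i, D i -> mu.-negligible (F i)) ->
  mu.-negligible (\bigcup_(i in D) F i).
Proof.
move=> /countable_injP[f injf] F0.
apply: (negligibleS (A := \bigcup_n \bigcup_(i in D `&` [set i | f i = n]) F i)).
  by move=> y [i Di Fiy]; exists (f i) => //; exists i.
apply: negligible_bigcup => n.
have [[i Di fin]|noi] := pselect (exists2 i, D i & f i = n).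
  apply: negligibleS (F0 i Di) => y [j [Dj /= fjn] Fjy].
  by rewrite (injf i j) ?inE// fin fjn.
apply: negligibleS (negligible_set0 mu) => y [j [Dj /= fjn] _].
by case: noi; exists j.
Qed.

(** Sort the indices by a lower bound [1/(n+1)] on the mass of [F i]. Each layer is finite:
    infinitely many disjoint sets of that mass would not fit in [A]. *)
Lemma trivIset_positive_mass_countable d (T : sigmaRingType d) (R : realType)
    (mu : {measure set T -> \bar R}) (J : pointedType) (D : set J)
    (F : J -> set T) (A : set T) :
  measurable A -> (mu A < +oo)%E -> trivIset D F ->
  (forall i, D i -> [/\ measurable (F i), F i `<=` A & (0 < mu (F i))%E]) ->
  countable D.
Proof.
move=> mA Aoo tF DF.
have muF i : D i -> (mu (F i) <= mu A)%E.
  by move=> /DF[mFi FA _]; apply: le_measure; rewrite ?inE.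
have muFfin i : D i -> mu (F i) \is a fin_num.
  by move=> Di; rewrite ge0_fin_numE// (le_lt_trans (muF _ Di)).
have -> : D = \bigcup_n [set i | D i /\ (n.+1%:R^-1%:E < mu (F i))%E].
  apply/seteqP; split => [i Di|i [n _ []]//].
  have [_ _] := DF _ Di; rewrite -(fineK (muFfin _ Di)) lte_fin.
  move=> /ltr_add_invr[k]; rewrite add0r => Hk; exists k => //=; split => //.
  by rewrite -(fineK (muFfin _ Di)) lte_fin.
apply: bigcup_countable => // n _; apply: finite_set_countable.
apply: contrapT => /infiniteP/pcard_leP/injfunPex[/= q q_fun q_inj].
have Dq k : D (q k) by have [] := q_fun k I.
have tq : trivIset setT (F \o q).
  apply/trivIsetP => i j _ _ ij; move/trivIsetP : tF; apply => //.
  by apply: contra_neq ij => /q_inj; apply; rewrite inE.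
have : (mu (\bigcup_k F (q k)) <= mu A)%E.
  apply: le_measure; rewrite ?inE//.
    by apply: bigcupT_measurable => k; have [] := DF _ (Dq k).
  by move=> x [k _]; have [_ + _] := DF _ (Dq k); exact.
rewrite measure_bigcup//; last by move=> k _; have [] := DF _ (Dq k).
apply/negP; rewrite -ltNge.
have Afin : mu A \is a fin_num by rewrite ge0_fin_numE.
(* [N] disjoint sets of mass at least [1/(n+1)] already have total mass above [mu A]. *)
pose N := (Num.truncn (fine (mu A) * n.+1%:R)).+1.
rewrite (eq_eseriesl (Q := xpredT)); last by move=> k; rewrite in_setT.
apply: (lt_le_trans _ (nneseries_lim_ge N _)) => //.
apply: (@lt_le_trans _ _ (\sum_(0 <= k < N) n.+1%:R^-1%:E)%E); last first.
  by apply: lee_sum => k _; have [_ /ltW] := q_fun k I.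
rewrite sumEFin sumr_const_nat subn0 -(fineK Afin) lte_fin -[ltRHS]mulr_natl.
by rewrite ltr_pdivlMr// truncnS_gt.
Qed.

(** * Balls, support and total boundedness in one pointed metric measure space *)

Section pointed_metric_space.
Context {R : realType} (Y : pmetricType R).
Implicit Types (x y : Y) (r : R) (D : set Y).

Lemma BallC (A : set Y) : Ball A -> Ball (~` A).
Proof. exact: measurableC. Qed.

Lemma BallU (A B : set Y) : Ball A -> Ball B -> Ball (A `|` B).
Proof. exact: measurableU. Qed.

Lemma BallI (A B : set Y) : Ball A -> Ball B -> Ball (A `&` B).
Proof. exact: measurableI. Qed.

Lemma BallD (A B : set Y) : Ball A -> Ball B -> Ball (A `\` B).
Proof. exact: measurableD. Qed.

Lemma Ball_bigcapT (F : (set Y)^nat) :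
  (forall n, Ball (F n)) -> Ball (\bigcap_n F n).
Proof. exact: bigcapT_measurable. Qed.

Lemma Ball_bigcup I (D : set I) (F : I -> set Y) : countable D ->
  (forall i, D i -> Ball (F i)) -> Ball (\bigcup_(i in D) F i).
Proof. exact: countable_bigcup_measurable. Qed.

(** [open_balls] admits positive radii only; the other radii occur later, as in [r - n.+1%:R^-1]. *)
Lemma ball_le0 x r : r <= 0 -> ball x r = set0.
Proof.
move=> r0; rewrite ballEmdist; apply/seteqP; split => // y /= /lt_le_trans.
by move=> /(_ _ r0); rewrite ltNge mdist_ge0.
Qed.

Lemma Ball_ball x r : Ball (ball x r).
Proof.
have [r0|r0] := leP r 0; first by rewrite ball_le0//; exact: measurable0.
by apply: sub_gen_smallest; exists x, r.
Qed.

Lemma Ball_cball x r : Ball (cball x r).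
Proof.
have -> : cball x r = \bigcap_n ball x (r + n.+1%:R^-1).
  apply/seteqP; split => [y /= xy n _|y H].
    by rewrite ballEmdist/= (le_lt_trans xy)// ltrDl invr_gt0.
  rewrite /cball/= leNgt; apply/negP => /ltr_add_invr[k].
  by rewrite ltNge; apply/negP/negPn; have := H k I; rewrite ballEmdist => /ltW.
by apply: Ball_bigcapT => n; exact: Ball_ball.
Qed.

Lemma Ball_bigcup_ball I (D : set I) (x : I -> Y) r : countable D ->
  Ball (\bigcup_(i in D) ball (x i) r).
Proof.
by move=> cD; apply: Ball_bigcup => // i _; exact: Ball_ball.
Qed.

Lemma closure_mdist D y :
  closure D y <-> forall r, 0 < r -> exists2 x, D x & mdist x y < r.
Proof.
split=> [cDy r r0|H B /nbhs_ballP[r /= r0 rB]].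
  have [x [Dx]] := cDy _ (nbhsx_ballx y r r0).
  by rewrite ballEmdist/= metric_sym => xy; exists x.
have [x Dx xy] := H r r0; exists x; split => //; apply: rB.
by rewrite ballEmdist/= metric_sym.
Qed.

(** Without separability, closed sets need not lie in [Ball]. This formula uses only balls centred
    in [D], which settles the case of countable [D]. *)
Lemma closureE_bigcup_ball D :
  closure D = \bigcap_n \bigcup_(x in D) ball x n.+1%:R^-1.
Proof.
apply/seteqP; split => [y /closure_mdist cDy n _|y H].
  have [x Dx xy] := cDy n.+1%:R^-1 ltac:(by rewrite invr_gt0).
  by exists x => //; rewrite ballEmdist.
apply/closure_mdist => r /ltr_add_invr[k]; rewrite add0r => kr.
have [x Dx] := H k I; rewrite ballEmdist/= => xy; exists x => //.
exact: lt_trans kr.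
Qed.

Lemma Ball_closure D : countable D -> Ball (closure D).
Proof.
move=> cD; rewrite closureE_bigcup_ball; apply: Ball_bigcapT => n.
exact: Ball_bigcup_ball.
Qed.

Variable nu : {measure set (ballType Y) -> \bar R}.

Lemma le_mass (A B : set Y) : Ball A -> Ball B -> A `<=` B -> (nu A <= nu B)%E.
Proof. by move=> mA mB AB; apply: le_measure; rewrite ?inE. Qed.

Lemma spt_closed : closed (spt nu).
Proof.
move=> y /closure_mdist cy r r0.
have [x sx xy] := cy (r / 2) ltac:(by rewrite divr_gt0).
apply: lt_le_trans (sx (r / 2) ltac:(by rewrite divr_gt0)) _.
apply: le_mass; [exact: Ball_ball|exact: Ball_ball|] => z.
rewrite !ballEmdist/= => xz; rewrite (le_lt_trans (metric_triangle _ x _))//.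
by rewrite metric_sym (splitr r) ltrD.
Qed.

Hypothesis nu_fin : forall r, (nu (ball point r) < +oo)%E.

(** At each scale [1/(k+1)], take a maximal family of disjoint balls centred in the support. They
    have positive mass, so only countably many centres lie in each bounded region, and maximality
    makes the centres [2/(k+1)]-dense. *)
Lemma spt_separable : separable (spt nu).
Proof.
pose B (k : nat) x := ball x (k.+1%:R^-1 : R).
pose D k := sval (ex_maximal_disjoint_subcollection (B k) (spt nu)).
have Dmax k := svalP (ex_maximal_disjoint_subcollection (B k) (spt nu)).
exists (\bigcup_k D k); split.
- apply: bigcup_countable => // k _.
  have -> : D k = \bigcup_n (D k `&` ball point n%:R).
    apply/seteqP; split => [x Dx|x [n _ []]//].
    exists (Num.truncn (mdist point x)).+1 => //; split => //.
    by rewrite ballEmdist/= truncnS_gt.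
  apply: bigcup_countable => // n _.
  have [Ds tD _] := Dmax k.
  apply: (@trivIset_positive_mass_countable _ (ballType Y) _ nu _ _ (B k)
    (ball point (n%:R + k.+1%:R^-1))) => //.
  + exact: Ball_ball.
  + by apply: sub_trivIset tD => x [].
  + move=> x [Dx pxn]; split; first exact: Ball_ball.
      by move=> z; exact: ball_triangle.
    by apply: (Ds _ Dx); rewrite invr_gt0.
- by move=> x [k _]; have [+ _ _] := Dmax k; exact.
- move=> y sy; apply/closure_mdist => r r0.
  have [k] := ltr_add_invr (y := 0) (x := r / 2) ltac:(by rewrite divr_gt0).
  rewrite add0r => kr.
  have [Ds /trivIsetP tD Dmx] := Dmax k; rewrite -/(D k) in Ds tD Dmx.
  apply: contrapT => noD.
  have nDy : ~ D k y.
    by move=> Dy; apply: noD; exists y; [exists k|rewrite mdistxx].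
  (* If no centre is within [r] of [y], then [y] can be added to the maximal family: intersecting
     balls of radius [1/(k+1) < r/2] have centres less than [r] apart. *)
  apply: (Dmx (y |` D k)).
  + split; first by move=> x; right.
    by move=> /(_ y) H; apply: nDy; apply: H; left.
  + by move=> x [->|/Ds].
  have disj x : D k x -> B k x `&` B k y = set0.
    move=> Dx; apply/seteqP; split => // z [xz yz]; apply: noD.
    exists x; first by exists k.
    move: xz yz; rewrite /B !ballEmdist/= => xz yz.
    rewrite (le_lt_trans (metric_triangle _ z _))// (splitr r).
    by rewrite ltrD ?(lt_trans xz)// metric_sym (lt_trans yz).
  apply/trivIsetP => a b [->|Da] [->|Db] ab.
  + by rewrite eqxx in ab.
  + by rewrite setIC; exact: disj.
  + exact: disj.
  + exact: tD.
Qed.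

(** What the first [n] balls around a dense sequence of [C] leave uncovered decreases to a part of
    the null complement of [C]. *)
Lemma concentrated_separable_totally_bounded (C : set Y) :
  separable C -> concentrated nu C -> boundedly_totally_bounded nu.
Proof.
move=> [D [cD DC CD]] [mC C0] r0 r e r0_gt0 r_gt0 e_gt0.
have /countable_injP[f injf] := cD.
(* [g] inverts the coding [f]. Off the codes of [D] its value is a default point, whose ball can
   only shrink [F n]. *)
pose g n := get [set x | D x /\ f x = n].
have Dg x : D x -> g (f x) = x.
  move=> Dx; rewrite /g; case: (@getPex _ [set y | D y /\ f y = f x]).
    by exists x.
  by move=> Dy fyx; apply: injf; rewrite ?inE.
pose F n := cball point r0 `\` \bigcup_(k < n) ball (g k) r.
have mU n : Ball (\bigcup_(k < n) ball (g k) r).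
  exact: Ball_bigcup_ball.
have mF n : Ball (F n) by apply: BallD => //; exact: Ball_cball.
have F0 : nu (\bigcap_n F n) = 0%E.
  apply/eqP; rewrite -measure_le0 -C0; apply: le_mass.
  - exact: Ball_bigcapT.
  - exact: BallC.
  - move=> y Fy /CD/closure_mdist/(_ _ r_gt0)[x Dx xy].
    (* [F n] removes the balls of index below [n], hence the one around [x] only from [(f x).+1]
       on. *)
    have [_] := Fy (f x).+1 I; apply; exists (f x) => //=.
    by rewrite Dg// ballEmdist.
have : nu (F n) @[n --> \oo] --> 0%E.
  rewrite -F0; apply: nonincreasing_cvg_mu => //.
  - apply: le_lt_trans (nu_fin (r0 + 1)); apply: le_mass => //.
      exact: Ball_ball.
    by move=> x [/= px _]; rewrite ballEmdist/= (le_lt_trans px)// ltrDl.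
  - exact: Ball_bigcapT.
  - move=> a b ab; apply/subsetPset; apply: setDS => x [k /= ka xk].
    by exists k => //=; exact: leq_trans ab.
move=> /(_ [set x | (x <= e%:E)%E])[].
  have : nbhs 0%E [set x : \bar R | (x < e%:E)%E].
    by apply: open_nbhs_nbhs; split => //; exact: open_ereal_lt_ereal.
  by apply: filterS => x /ltW.
move=> n _ /(_ n (leqnn n)) /= Fe; exists n, (g \o val).
apply: le_trans Fe; apply: le_mass => //.
- apply: BallD; first exact: Ball_cball.
  exact: Ball_bigcup_ball.
- by apply: setDS => x [k kn xk]; exists (Ordinal kn).
Qed.

(** The support is not known in advance to lie in [Ball]. The identity [sptE] gives this together
    with the nullity of the complement, as it uses only the closure of a countable set and countably
    many null balls. *)
Lemma totally_bounded_concentrated :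
  boundedly_totally_bounded nu -> concentrated nu (spt nu).
Proof.
move=> tb.
(* The index [kj.1] sends the radius to infinity and the mesh to zero. The error has its own index
   [kj.2], so that [N k] below is null at a fixed [k]. *)
have {tb}/choice[M /choice[x xM]] (kj : nat * nat) :
    exists M, exists x : nat -> Y,
    (nu (cball point kj.1.+1%:R `\` \bigcup_(n < M) ball (x n) kj.1.+1%:R^-1)
     <= kj.2.+1%:R^-1%:E)%E.
  have [||| M [x xM]] := tb kj.1.+1%:R kj.1.+1%:R^-1 kj.2.+1%:R^-1.
  - by [].
  - by rewrite invr_gt0.
  - by rewrite invr_gt0.
  (* Points past the first [M] are set to [point], so that all families become sequences. *)
  exists M, (fun n => oapp x point (insub n)).
  apply: le_trans xM; apply: le_mass.
  - apply: BallD; first exact: Ball_cball.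
    exact: Ball_bigcup_ball.
  - apply: BallD; first exact: Ball_cball.
    exact: Ball_bigcup_ball.
  - apply: setDS => y [i _ xy]; exists (val i) => /=; first exact: ltn_ord.
    by rewrite valK.
pose D := \bigcup_kj range (x kj).
have cD : countable D.
  apply: bigcup_countable => // kj _.
  exact: sub_countable (card_image_le _ _) _.
have D0 : nu.-negligible (~` closure D).
  pose N k := cball (point : Y) k.+1%:R `\` \bigcup_(x in D) ball x k.+1%:R^-1.
  have mN k : Ball (N k).
    apply: BallD; first exact: Ball_cball.
    exact: Ball_bigcup_ball.
  apply: (@negligibleS _ (ballType Y) _ nu (\bigcup_k N k)); last first.
    apply: negligible_bigcup => k; exists (N k); split=> [||//]; first exact: mN.
    apply/eqP; rewrite -measure_le0; apply/lee_addgt0Pr => e e0.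
    have [j] := ltr_add_invr e0; rewrite !add0r => je.
    apply: (@le_trans _ _ j.+1%:R^-1%:E); last by rewrite lee_fin ltW.
    apply: le_trans (xM (k, j)); apply: le_mass => //=.
      apply: BallD; first exact: Ball_cball.
      exact: Ball_bigcup_ball.
    apply: setDS => y [n _ xy]; exists (x (k, j) n) => //.
    by exists (k, j) => //; exists n.
  move=> y nDy; apply: contrapT => nNy; apply: nDy; apply/closure_mdist => r r0.
  have [k0] := ltr_add_invr r0; rewrite add0r => k0r.
  apply: contrapT => noD; apply: nNy.
  (* The closed ball of radius [k+1] must reach [y], and [1/(k+1)] must stay below [r]. *)
  pose k := maxn k0 (Num.truncn (mdist point y)); exists k => //; split.
    rewrite /cball/= ltW// (lt_le_trans (truncnS_gt _))// ler_nat ltnS.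
    exact: leq_maxr.
  move=> [z Dz]; rewrite ballEmdist/= => zy; apply: noD; exists z => //.
  rewrite (lt_trans zy)// (le_lt_trans _ k0r)// lef_pV2 ?posrE//.
  by rewrite ler_nat ltnS leq_maxl.
pose J : set (Y * nat) := [set xk | D xk.1 /\ nu (ball xk.1 xk.2.+1%:R^-1) = 0%E].
have cJ : countable J.
  apply: (@sub_countable _ _ _ (D `*` [set: nat])); last exact: countableX.
  by apply: subset_card_le => -[a k] [].
have sptE : ~` spt nu =
    ~` closure D `|` \bigcup_(xk in J) ball xk.1 xk.2.+1%:R^-1.
  apply/seteqP; split => [y nsy|y yN sy].
    have [cDy|] := pselect (closure D y); [right|by left].
    move: nsy => /existsNP[r /not_implyP[r0 /negP]]; rewrite -leNgt measure_le0.
    move=> /eqP yr0.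
    (* With [1/(k+1) < r/2], a point [z] of [D] that close to [y] has its ball inside the null ball
       [ball y r]. *)
    have [k] := ltr_add_invr (y := 0) (x := r / 2) ltac:(by rewrite divr_gt0).
    rewrite add0r => kr.
    have [z Dz zy] := (closure_mdist D y).1 cDy k.+1%:R^-1
      ltac:(by rewrite invr_gt0).
    exists (z, k); last by rewrite ballEmdist.
    split => //=; apply/eqP; rewrite -measure_le0 -yr0; apply: le_mass.
    - exact: Ball_ball.
    - exact: Ball_ball.
    - move=> t; rewrite !ballEmdist/= => zt.
      rewrite (le_lt_trans (metric_triangle _ z _))// (splitr r).
      by rewrite ltrD ?(lt_trans zt)// metric_sym (lt_trans zy).
  have null_ball r : 0 < r -> nu (ball y r) <> 0%E.
    by move=> /sy; rewrite lt0e => /andP[/eqP].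
  case: yN => [ncDy|[[z k] [Dz /= zk0]]].
    have : exists2 r, 0 < r & ball y r `<=` ~` closure D.
      have /closed_openC := @closed_closure _ D; rewrite openE => /(_ y ncDy).
      by move=> /nbhs_ballP[r /= r0 H]; exists r.
    move=> [r r0 yr]; apply: (null_ball r r0); apply/eqP; rewrite -measure_le0.
    have : nu (~` closure D) = 0%E.
      by apply/(negligibleP _ _) => //; apply: BallC; exact: Ball_closure.
    move=> <-; apply: le_mass => //; first exact: Ball_ball.
    by apply: BallC; exact: Ball_closure.
  rewrite ballEmdist/= => zy.
  have d0 : 0 < k.+1%:R^-1 - mdist z y by rewrite subr_gt0.
  apply: (null_ball _ d0); apply/eqP; rewrite -measure_le0 -zk0; apply: le_mass.
  - exact: Ball_ball.
  - exact: Ball_ball.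
  - move=> t; rewrite !ballEmdist/= => yt.
    by rewrite (le_lt_trans (metric_triangle _ y _))// -ltrBrDl.
have mspt : Ball (~` spt nu).
  rewrite sptE; apply: BallU.
    by apply: BallC; exact: Ball_closure.
  by apply: Ball_bigcup => // i _; exact: Ball_ball.
split; first by rewrite -(setCK (spt nu)); exact: BallC.
apply/(negligibleP _ _) => //; rewrite sptE; apply: negligibleU => //.
apply: countable_bigcup_negligible => // -[z k] [_ /= zk0].
by exists (ball z k.+1%:R^-1); split=> [||//]; [exact: Ball_ball|exact: zk0].
Qed.

End pointed_metric_space.

(** * Internal sets and their outer measure *)

Lemma nonprincipal_near_ge (w : set_system nat) (U : UltraFilter w) :
  (forall n : nat, w <> principal_filter n) ->
  forall n, \forall i \near w, (n <= i)%N.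
Proof.
move=> wnp; elim=> [|n IH]; first exact: nearW.
have [wn|] := in_ultra_setVsetC [set n] U.
  (* An ultrafilter containing the singleton of [n] lies in the principal filter at [n], and equals
     it by maximality. *)
  case: (wnp n); apply/esym/max_filter; first exact: principal_filter_proper.
  move=> A wA; apply/principal_filterP.
  by have [i [Ai <-]] := filter_ex (filterI wA wn).
by apply: filterS2 IH => i; rewrite leq_eqVlt => /predU1P[->|//] [].
Qed.

Section ultralimit_outer_measure.
Context {R : realType} (w : set_system nat) {U : UltraFilter w}.
Hypothesis w_nonprincipal : forall n : nat, w <> principal_filter n.
Variables (X : nat -> pmetricType R).
Variable m : forall i, {measure set (ballType (X i)) -> \bar R}.
Implicit Types A B C : forall i, set (X i).
Local Open Scope ereal_scope.

Lemma ulim_lt_near (u : nat -> \bar R) (c : \bar R) :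
  lim (u i @[i --> w]) < c -> \forall i \near w, u i < c.
Proof.
move=> uc; apply: (@ulim_cvg _ _ U u [set x | x < c]).
by apply: open_nbhs_nbhs; split => //; exact: open_ereal_lt_ereal.
Qed.

Lemma le_ulim (u v : nat -> \bar R) : (\forall i \near w, u i <= v i) ->
  lim (u i @[i --> w]) <= lim (v i @[i --> w]).
Proof. by move=> uv; apply: lee_lim => //; exact: ulim_cvg. Qed.

Lemma ulimD (u v : nat -> \bar R) :
  (forall i, 0 <= u i) -> (forall i, 0 <= v i) ->
  lim (u i + v i @[i --> w]) = lim (u i @[i --> w]) + lim (v i @[i --> w]).
Proof.
move=> u0 v0; apply/cvg_lim => //; apply: cvgeD; [|exact: ulim_cvg..].
by rewrite ge0_adde_def// inE ulim_ge0.
Qed.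

Lemma ball_families_setI A B : ball_families A -> ball_families B ->
  ball_families (fun i => A i `&` B i).
Proof. by move=> mA mB i; apply: BallI; [exact: mA|exact: mB]. Qed.

Lemma ball_families_setU A B : ball_families A -> ball_families B ->
  ball_families (fun i => A i `|` B i).
Proof. by move=> mA mB i; apply: BallU; [exact: mA|exact: mB]. Qed.

Lemma ball_families_setD A B : ball_families A -> ball_families B ->
  ball_families (fun i => A i `\` B i).
Proof. by move=> mA mB i; apply: BallD; [exact: mA|exact: mB]. Qed.

Definition truncated_mass A (r : R) : \bar R :=
  lim (m i (A i `&` ball point r) @[i --> w]).

Let mAr A r i : ball_families A -> Ball (A i `&` ball point r).
Proof. by move=> mA; apply: BallI; [exact: mA|exact: Ball_ball]. Qed.

Lemma truncated_mass_ge0 A r : 0 <= truncated_mass A r.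
Proof. exact: ulim_ge0. Qed.

Lemma le_truncated_mass A B r s : ball_families A -> ball_families B ->
  (\forall i \near w, A i `<=` B i) -> (r <= s)%R ->
  truncated_mass A r <= truncated_mass B s.
Proof.
move=> mA mB AB rs; apply: le_ulim; apply: filterS AB => i AB.
by apply: le_mass; [exact: mAr..|apply: setISS => //; exact: le_ball].
Qed.

(** Additivity of each [m i] survives because the ultralimit commutes with sums of nonnegative
    terms. *)
Lemma truncated_mass_setID A B r : ball_families A -> ball_families B ->
  truncated_mass A r = truncated_mass (fun i => A i `&` B i) r +
                       truncated_mass (fun i => A i `\` B i) r.
Proof.
move=> mA mB; rewrite /truncated_mass -ulimD//; apply: ulim_near.
apply: nearW => i; rewrite -[RHS]measureU.
- by rewrite -setIUl setUIDK.
- exact: (mAr r (ball_families_setI mA mB)).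
- exact: (mAr r (ball_families_setD mA mB)).
- by apply/seteqP; split=> // x [[[_ Bx] _] [[_ nBx] _]].
Qed.

Lemma truncated_mass_nondecreasing A : ball_families A ->
  nondecreasing_fun (truncated_mass A).
Proof.
move=> mA r s rs; apply: le_truncated_mass => //.
by apply: nearW => i; exact: subset_refl.
Qed.

Lemma family_mass_cvg A : ball_families A ->
  truncated_mass A r @[r --> +oo%R] --> family_mass w m A.
Proof.
by move=> mA; apply: nondecreasing_is_cvge; exact: truncated_mass_nondecreasing.
Qed.

(** Monotonicity in the radius turns the outer limit into a supremum, so upper bounds need only be
    checked at each fixed radius. *)
Lemma family_massE A : ball_families A ->
  family_mass w m A = ereal_sup (range (truncated_mass A)).
Proof.
move=> mA; apply/cvg_lim => //; apply: nondecreasing_cvge.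
exact: truncated_mass_nondecreasing.
Qed.

Lemma family_mass_le A s : ball_families A ->
  (forall r, truncated_mass A r <= s) -> family_mass w m A <= s.
Proof.
by move=> mA As; rewrite family_massE//; apply: ge_ereal_sup => _ [r _ <-].
Qed.

Lemma truncated_mass_le A r : ball_families A ->
  truncated_mass A r <= family_mass w m A.
Proof.
by move=> mA; rewrite family_massE//; apply: ereal_sup_ubound; exists r.
Qed.

Lemma family_mass_ge0 A : ball_families A -> 0 <= family_mass w m A.
Proof.
move=> mA; apply: le_trans (truncated_mass_le 0 mA).
exact: truncated_mass_ge0.
Qed.

Lemma le_family_mass A B : ball_families A -> ball_families B ->
  (\forall i \near w, A i `<=` B i) -> family_mass w m A <= family_mass w m B.
Proof.
move=> mA mB AB; apply: family_mass_le => // r.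
apply: le_trans (truncated_mass_le r mB); exact: le_truncated_mass.
Qed.

Lemma family_mass_setID A B : ball_families A -> ball_families B ->
  family_mass w m A = family_mass w m (fun i => A i `&` B i) +
                      family_mass w m (fun i => A i `\` B i).
Proof.
move=> mA mB.
have mI := ball_families_setI mA mB; have mD := ball_families_setD mA mB.
apply/cvg_lim => //.
rewrite [X in X @ _](_ : _ = fun r => truncated_mass (fun i => A i `&` B i) r +
    truncated_mass (fun i => A i `\` B i) r); last first.
  by apply/funext => r; exact: truncated_mass_setID.
apply: cvgeD; [|exact: family_mass_cvg..].
by rewrite ge0_adde_def// inE family_mass_ge0.
Qed.

Lemma family_mass_setU A B : ball_families A -> ball_families B ->
  family_mass w m (fun i => A i `|` B i) <= family_mass w m A + family_mass w m B.
Proof.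
move=> mA mB.
have mU := ball_families_setU mA mB.
rewrite (family_mass_setID mU mA); apply: leeD; apply: le_family_mass => //.
- exact: ball_families_setI.
- by apply: nearW => i; exact: subIsetr.
- exact: ball_families_setD.
- by apply: nearW => i x [[]].
Qed.

Lemma family_mass_set0 : family_mass w m (fun=> set0) = 0.
Proof.
apply/eqP; rewrite eq_le family_mass_ge0 ?andbT; last first.
  by move=> i; exact: measurable0.
apply: family_mass_le => [i|r]; first exact: measurable0.
rewrite /truncated_mass; under eq_fun do rewrite set0I measure0.
by rewrite ulim_const.
Qed.

Lemma family_mass_bigcup (A : nat -> forall i, set (X i)) n :
  (forall k, ball_families (A k)) ->
  family_mass w m (fun i => \bigcup_(k < n) A k i) <=
  \sum_(0 <= k < n) family_mass w m (A k).
Proof.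
move=> mA; elim: n => [|n IH].
  rewrite big_nil (_ : (fun _ => _) = fun=> set0) ?family_mass_set0//.
  by apply/functional_extensionality_dep => i; rewrite II0 bigcup_set0.
rewrite big_nat_recr//=; apply: le_trans (leeD2r _ IH).
rewrite (_ : (fun _ => _) = fun i => \bigcup_(k < n) A k i `|` A n i).
  by apply: family_mass_setU => // i; apply: Ball_bigcup => // k _; exact: mA.
apply/functional_extensionality_dep => i.
by rewrite IIS bigcup_setU bigcup_set1.
Qed.

(* Countable saturation: along an index k(i) -> oo chosen so that the mass of the
   first k(i) sets in the ball of radius k(i) is almost at most s, the finite
   unions diagonalise to a single internal set. *)
Lemma internal_saturation (A : nat -> forall i, set (X i)) (s : \bar R) :
  (forall k, ball_families (A k)) ->
  (forall n, family_mass w m (fun i => \bigcup_(k < n) A k i) <= s) ->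
  exists B, [/\ ball_families B,
    forall k, internal (U := U) (A k) `<=` internal B &
    family_mass w m B <= s].
Proof.
move=> mA As.
pose V n i := \bigcup_(k < n) A k i.
have mV n : ball_families (V n).
  by move=> i; apply: Ball_bigcup => // k _; exact: mA.
have s0 : 0 <= s by exact: le_trans (family_mass_ge0 (mV 0%N)) (As 0%N).
pose P n i := m i (V n i `&` ball point n%:R) <= s + n.+1%:R^-1%:E.
have Pnear n : \forall i \near w, P n i.
  have [s_oo|soo] := eqVneq s +oo.
    by apply: nearW => i; rewrite /P s_oo addye// leey.
  have sfin : s \is a fin_num by rewrite ge0_fin_numE// ltey.
  have : truncated_mass (V n) n%:R < s + n.+1%:R^-1%:E.
    apply: le_lt_trans (le_trans (truncated_mass_le _ (mV n)) (As n)) _.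
    by rewrite lteDl// lte_fin invr_gt0.
  by move=> /ulim_lt_near; apply: filterS => i /ltW.
have P0 i : P 0%N i.
  by rewrite /P /V II0 bigcup_set0 set0I measure0 adde_ge0// lee_fin invr_ge0.
(* [k i] is the largest [n <= i] with [P n i]. It exists since [P 0 i] always holds, and it tends to
   infinity along [w] since each [P n] holds almost everywhere and [w] contains all tails. *)
have /choice[k kP] i : exists k,
    P k i /\ forall n, (n <= i)%N -> P n i -> (n <= k)%N.
  have exQ : exists n, (n <= i)%N && `[< P n i >].
    by exists 0%N; rewrite leq0n; exact/asboolP.
  have boundQ n : (n <= i)%N && `[< P n i >] -> (n <= i)%N by case/andP.
  case: (ex_maxnP exQ boundQ) => k /andP[_ /asboolP Pk] kmax.
  exists k; split=> //.
  by move=> n ni Pn; apply: kmax; rewrite ni; exact/asboolP.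
have k_near n : \forall i \near w, (n <= k i)%N.
  have := nonprincipal_near_ge U w_nonprincipal n.
  by apply: filterS2 (Pnear n) => i Pni ni; exact: (kP i).2.
have mB : ball_families (fun i => V (k i) i) by move=> i; exact: mV.
exists (fun i => V (k i) i); split=> //.
- move=> j x; apply: filterS2 (k_near j.+1) => i jk Ax.
  by exists j.
- apply: family_mass_le => // r; apply/lee_addgt0Pr => e e0.
  have [N] := ltr_add_invr e0; rewrite add0r => Ne.
  (* [n] exceeds [r], so the ball of radius [r] lies in that of radius [k i], and [1/(n+1) < e]. *)
  pose n := maxn N (Num.truncn r).+1.
  apply: lime_le; first exact: ulim_cvg.
  apply: filterS (k_near n) => i nk.
  apply: (@le_trans _ _ (m i (V (k i) i `&` ball point (k i)%:R))).
    apply: le_mass; [exact: (mAr _ mB)|exact: (mAr _ mB)|].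
    apply: setIS; apply: le_ball; rewrite ltW// (lt_le_trans (truncnS_gt _))//.
    by rewrite ler_nat (leq_trans _ nk)// leq_maxr.
  apply: le_trans (kP i).1 _; rewrite leeD2l// lee_fin ltW// (le_lt_trans _ Ne)//.
  by rewrite lef_pV2 ?posrE// ler_nat ltnS (leq_trans _ nk)// leq_maxl.
Qed.

Lemma internal_setI A B :
  internal (fun i => A i `&` B i) = internal A `&` internal (U := U) B.
Proof.
apply/seteqP; split=> [x ABx|x [Ax Bx]]; last exact: filterI Ax Bx.
by split; apply: filterS ABx => i [].
Qed.

Lemma internal_setC A : internal (fun i => ~` A i) = ~` internal (U := U) A.
Proof.
apply/seteqP; split=> [x nAx Ax|x nAx].
  by have [i []] := filter_ex (filterI nAx Ax).
by have [] := in_ultra_setVsetC [set i | A i (repr (val x) i)] U.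
Qed.

Lemma internal_setD A B :
  internal (fun i => A i `\` B i) = internal A `\` internal (U := U) B.
Proof. by rewrite setDE -internal_setC -internal_setI. Qed.

(** The inclusion concerns the finite part only, not the sets [A i] and [B i]. It gives [A] and its
    intersection with [B] the same internal set, on which alone the mass depends by
    [internal_massE]. *)
Lemma internal_le_mass A B : ball_families A -> ball_families B ->
  internal (U := U) A `<=` internal B -> family_mass w m A <= family_mass w m B.
Proof.
move=> mA mB AB.
have mI := ball_families_setI mA mB.
rewrite -(internal_massE (U := U) m mA) -(setIidl AB) -internal_setI.
rewrite internal_massE//.
by apply: le_family_mass => //; apply: nearW => i; exact: subIsetr.
Qed.

Definition internal_outer (N : set (finpart w X)) : \bar R :=
  ereal_inf [set family_mass w m A | A in
    [set A | ball_families A /\ N `<=` internal A]].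

Lemma internal_outer_le N A : ball_families A -> N `<=` internal A ->
  internal_outer N <= family_mass w m A.
Proof. by move=> mA NA; apply: ereal_inf_lbound; exists A. Qed.

Lemma internal_outerE A : ball_families A ->
  internal_outer (internal A) = family_mass w m A.
Proof.
move=> mA; apply/eqP; rewrite eq_le internal_outer_le//=.
by apply: le_ereal_inf_tmp => _ [B [mB AB] <-]; exact: internal_le_mass.
Qed.

Lemma internal_outer_ge0 N : 0 <= internal_outer N.
Proof.
by apply: le_ereal_inf_tmp => _ [B [mB _] <-]; exact: family_mass_ge0.
Qed.

Lemma internal_outer_adherent N (e : R) : internal_outer N < +oo -> (0 < e)%R ->
  exists A, [/\ ball_families A, N `<=` internal A &
    family_mass w m A < internal_outer N + e%:E].
Proof.
move=> Noo e0.
have Nfin : internal_outer N \is a fin_num.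
  by rewrite ge0_fin_numE// internal_outer_ge0.
by have [_ [A [mA NA] <-] Ae] := lb_ereal_inf_adherent e0 Nfin; exists A.
Qed.

Let internal_outer_set0 : internal_outer set0 = 0.
Proof.
apply/eqP; rewrite eq_le internal_outer_ge0 andbT -family_mass_set0.
by apply: internal_outer_le => // i; exact: measurable0.
Qed.

Lemma le_internal_outer : {homo internal_outer : M N / M `<=` N >-> M <= N}.
Proof.
move=> M N MN; apply: ereal_inf_le_tmp => _ [A [mA NA] <-]; exists A => //.
by split => //; exact: subset_trans NA.
Qed.

(** Cover [N k] with error [e / 2^(k+1)]. The finite unions of the covers have mass at most the sum
    plus [e], and saturation puts all covers into one internal set under the same bound. *)
Let internal_outer_sigma_subadditive : sigma_subadditive internal_outer.
Proof.
move=> N; have [[k koo]|] := pselect (exists k, internal_outer (N k) = +oo).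
  rewrite (eseries_pinfty _ _ koo) ?leey// => n _.
  by rewrite -ltNye (lt_le_trans _ (internal_outer_ge0 _)).
rewrite -forallNE => Noo; apply/lee_addgt0Pr => e e0.
have /choice[A AP] k : exists A, [/\ ball_families A, N k `<=` internal A &
    family_mass w m A <= internal_outer (N k) + (e / (2 ^ k.+1)%:R)%:E].
  have [||A [mA NA Ae]] := @internal_outer_adherent (N k) (e / (2 ^ k.+1)%:R).
  - by rewrite ltey; exact/eqP/Noo.
  - by rewrite divr_gt0// ltr0n expn_gt0.
  - by exists A; split => //; exact: ltW.
have mA k : ball_families (A k) by have [] := AP k.
set S := leRHS.
have AS n : family_mass w m (fun i => \bigcup_(k < n) A k i) <= S.
  apply: le_trans (family_mass_bigcup n mA) _.
  apply: le_trans (epsilon_trick xpredT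
    (fun k => internal_outer_ge0 (N k)) (ltW e0)).
  apply: (@le_trans _ _ (\sum_(0 <= k < n)
      (internal_outer (N k) + (e / (2 ^ k.+1)%:R)%:E))).
    by apply: lee_sum => k _; have [] := AP k.
  apply: nneseries_lim_ge => k _; rewrite adde_ge0 ?internal_outer_ge0//.
  by rewrite lee_fin divr_ge0// ltW.
have [B [mB AB BS]] := internal_saturation mA AS.
apply: le_trans BS; apply: internal_outer_le => // x [k _ Nkx].
by apply: (AB k); have [_ + _] := AP k; exact.
Qed.

Definition ultralimit_outer : {outer_measure set (finpart w X) -> \bar R} :=
  HB.pack internal_outer (isOuterMeasure.Build R (finpart w X) internal_outer
    internal_outer_set0 internal_outer_ge0 le_internal_outer
    internal_outer_sigma_subadditive).

(** [A] cuts each internal cover of [N] into internal covers of the two parts of [N], and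
    [family_mass] is additive on this cut. *)
Lemma internal_caratheodory A : ball_families A ->
  ultralimit_outer.-caratheodory (internal A).
Proof.
move=> mA; apply: le_caratheodory_measurable => N.
apply: le_ereal_inf_tmp => _ [C [mC NC] <-]; rewrite (family_mass_setID mC mA).
apply: leeD; apply: internal_outer_le.
- exact: ball_families_setI.
- by rewrite internal_setI; exact: setSI.
- exact: ball_families_setD.
- by rewrite internal_setD setDE; exact: setSI.
Qed.

End ultralimit_outer_measure.

(** * The limit measure as an image of the Caratheodory measure *)

HB.instance Definition _ (R : realType) (w : set_system nat)
    (U : UltraFilter w) (X : nat -> pmetricType R) :=
  isPointed.Build (finpart w X) (ubase w X).

Section ultralimit_measure.
Context {R : realType} (w : set_system nat) {U : UltraFilter w}.
Hypothesis w_nonprincipal : forall n : nat, w <> principal_filter n.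
Variables (X : nat -> pmetricType R).
Variable m : forall i, {measure set (ballType (X i)) -> \bar R}.
Hypothesis m_ubf : unif_boundedly_finite w m.
Implicit Types A B C : forall i, set (X i).
Implicit Types (x : forall i, X i) (z : finpart w X).
Local Open Scope ereal_scope.

Lemma udist_uclass x z :
  udist (uclass w x) (val z) = lim ((mdist (x i) (repr (val z) i))%:E @[i --> w]).
Proof.
apply: ulim_near; apply: filterS (repr_uclass w x) => i -> //.
Qed.

Lemma internal_cball x z (r : R) :
  internal (fun i => cball (x i) r) z -> udist (uclass w x) (val z) <= r%:E.
Proof.
move=> xz; rewrite udist_uclass; apply: lime_le; first exact: ulim_cvg.
by apply: filterS xz => i; rewrite lee_fin.
Qed.

(** Strict inequalities become weak in the ultralimit, so limit balls and internal balls are only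
    sandwiched, by this bound and [internal_ball_lt]. *)
Lemma internal_ball_le x z (r : R) :
  internal (fun i => ball (x i) r) z -> udist (uclass w x) (val z) <= r%:E.
Proof.
move=> xz; apply: internal_cball; apply: filterS xz => i.
by rewrite ballEmdist => /ltW.
Qed.

Lemma internal_ball_lt x z (r : R) :
  udist (uclass w x) (val z) < r%:E -> internal (fun i => ball (x i) r) z.
Proof.
rewrite udist_uclass => /ulim_lt_near; apply: filterS => i.
by rewrite lte_fin ballEmdist.
Qed.

Lemma uprojK (a : ultralimit w X) : uproj (repr a) = a.
Proof. by rewrite /uproj reprK. Qed.

Lemma uclass_repr (z : ultraproduct w X) : uclass w (repr z) = z.
Proof. by rewrite /uclass reprK. Qed.

Lemma mdist_uproj (y z : finpart w X) :
  (mdist (uproj y) (uproj z))%:E = udist (val y) (val z).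
Proof. by rewrite -[mdist _ _]/(ulim_dist _ _) ulim_distE fineK// udist_fin. Qed.

Lemma ball_uproj (y z : finpart w X) (r : R) :
  ball (uproj y) r (uproj z) <-> udist (val y) (val z) < r%:E.
Proof. by rewrite ballEmdist -mdist_uproj lte_fin. Qed.

(** The slack [1/(n+1)] makes up for the strictness lost in the ultralimit. *)
Lemma uproj_preimage_ball (y : finpart w X) (r : R) :
  uproj @^-1` ball (uproj y) r =
  \bigcup_n internal (fun i => ball (repr (val y) i) (r - n.+1%:R^-1)).
Proof.
apply/seteqP; split=> [z /ball_uproj yz|z [n _ /internal_ball_le]].
  have yz_fin := udist_fin y z.
  rewrite -(fineK yz_fin) lte_fin in yz.
  have [n] := ltr_add_invr yz; exists n => //; apply: internal_ball_lt.
  by rewrite uclass_repr -(fineK yz_fin) lte_fin ltrBrDr.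
rewrite uclass_repr => yz; apply/ball_uproj; apply: le_lt_trans yz _.
by rewrite lte_fin gtrBl invr_gt0.
Qed.

Local Notation mu := (ultralimit_outer w_nonprincipal m).

Lemma ball_families_ball x (r : R) : ball_families (fun i => ball (x i) r).
Proof. by move=> i; exact: Ball_ball. Qed.

Lemma measurable_uproj :
  measurable_fun [set: caratheodory_type mu]
    (uproj : caratheodory_type mu -> ballType (ultralimit w X)).
Proof.
apply: (@measurability _ _ (caratheodory_type mu) (ballType (ultralimit w X)) _ _
  (@open_balls R (ultralimit w X))) => //.
move=> _ [_ [a [r r0 ->]] <-]; rewrite setTI -(uprojK a) uproj_preimage_ball.
apply: bigcupT_measurable => n.
by apply: internal_caratheodory; exact: ball_families_ball.
Qed.

(** A genuine measure, to which the results on a single space apply; [ulim_massE] identifies it with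
    the bare set function [ulim_mass] on [Ball]. *)
Definition ultralimit_measure :
    {measure set (ballType (ultralimit w X)) -> \bar R} :=
  measure_function_pushforward__canonical__measure_function_Measure
    mu measurable_uproj.

Lemma null_outer (N : set (finpart w X)) : null m N -> mu N = 0.
Proof.
move=> N0; apply/eqP; rewrite eq_le outer_measure_ge0 andbT.
apply/lee_addgt0Pr => e e0; rewrite add0e.
have [_ [[A mA <-] NA /ltW]] := N0 e e0; rewrite internal_massE//.
exact/le_trans/internal_outer_le.
Qed.

Lemma outer_null (N : set (finpart w X)) : mu N = 0 -> null m N.
Proof.
move=> N0 e e0.
have [|A [mA NA]] := internal_outer_adherent (m := m) (N := N) _ e0.
  by rewrite [ltLHS]N0.
rewrite [internal_outer _ _]N0 add0e => Ae; exists (internal A); split => //.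
  by exists A.
by rewrite internal_massE.
Qed.

(** A null symmetric difference leaves the outer measure unchanged, so the truncation picked by
    [get] does not matter. *)
Lemma truncations_mass (A B : set (finpart w X)) (r : R) :
  truncations m A r B ->
  internal_mass m B = mu (A `&` internal (fun=> ball point r)).
Proof.
move=> [[C mC <-] /null_outer]; set E := _ `&` _ => EC0.
rewrite internal_massE// -(internal_outerE m mC).
rewrite -[internal_outer m]/(mu : set _ -> _).
apply/eqP; rewrite eq_le; apply/andP; split.
- apply: (@le_trans _ _ (mu (E `|` (E `+` internal C)))).
    apply: le_outer_measure => z Cz; have [Ez|nEz] := pselect (E z); first by left.
    by right; right.
  by apply: le_trans (outer_measureU2 _ _ _) _; rewrite EC0 adde0.
- apply: (@le_trans _ _ (mu (internal C `|` (E `+` internal C)))).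
    apply: le_outer_measure => z Ez.
    have [Cz|nCz] := pselect (internal C z); first by left.
    by right; left.
  by apply: le_trans (outer_measureU2 _ _ _) _; rewrite EC0 adde0.
Qed.

Lemma family_mass_ball_fin (r : R) :
  family_mass w m (fun=> ball point r) < +oo.
Proof.
(* The uniform bound is available at positive radii only. *)
have [eta _ /(_ (Num.max r 1%R))] := m_ubf; rewrite lt_max ltr01 orbT => /(_ isT).
move=> bnd; apply: (@le_lt_trans _ _ (eta (Num.max r 1%R))%:E); last exact: ltry.
apply: family_mass_le; first exact: (ball_families_ball (fun=> point)).
move=> s; apply: lime_le; first exact: ulim_cvg.
apply: filterS bnd => i; apply: le_trans; apply: le_mass.
- by apply: BallI; exact: Ball_ball.
- exact: Ball_ball.
- by move=> x [+ _]; apply: le_ball; rewrite le_max lexx.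
Qed.

Lemma internal_bigcup (I : finType) (A : I -> forall i, set (X i)) z :
  internal (fun i => \bigcup_k A k i) z -> exists k, internal (A k) z.
Proof.
move=> Az; apply: contrapT => nA.
have nAk k : \forall i \near w, ~ A k i (repr (val z) i).
  have : internal (fun i => ~` A k i) z.
    by rewrite internal_setC => Akz; apply: nA; exists k.
  by [].
by have [i [[k _ Akz] /(_ k)]] := filter_ex (filterI Az (filter_forall _ nAk)).
Qed.

(** Outer covers [D n] of the complement of [E] in [C] give internal sets [A n] inside [E] that
    exhaust it up to [1/(n+1)]. Saturation encloses all of them in one internal [B] of mass at most
    [mu E], which then differs from [E] by a null set. *)
Lemma caratheodory_internal_ae (E : set (finpart w X)) C :
  mu.-caratheodory E -> ball_families C -> E `<=` internal C ->
  family_mass w m C < +oo ->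
  exists2 B, ball_families B & mu (E `+` internal B) = 0.
Proof.
move=> cE mC EC Coo.
have mui D : ball_families D -> mu (internal D) = family_mass w m D.
  exact: internal_outerE.
have Efin : mu E \is a fin_num.
  rewrite ge0_fin_numE ?outer_measure_ge0//.
  by apply: le_lt_trans Coo; rewrite -mui//; exact: le_outer_measure.
pose F := internal C `\` E.
have Foo : mu F < +oo.
  by apply: le_lt_trans Coo; rewrite -mui//; apply: le_outer_measure => z [].
have Ffin : mu F \is a fin_num by rewrite ge0_fin_numE ?outer_measure_ge0.
have /choice[D DP] n : exists D, [/\ ball_families D, F `<=` internal D &
    family_mass w m D <= mu F + n.+1%:R^-1%:E].
  have [||D [mD FD /ltW]] := internal_outer_adherent (m := m) (N := F)
    (e := n.+1%:R^-1) => //.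
  by exists D.
have mD n : ball_families (D n) by have [] := DP n.
pose A n i := C i `\` D n i.
have mA n : ball_families (A n) by exact: ball_families_setD.
have AE n : internal (A n) `<=` E.
  rewrite internal_setD => z [Cz nDz]; apply: contrapT => nEz; apply: nDz.
  by have [_ + _] := DP n; apply.
have EA n : mu (E `\` internal (A n)) <= n.+1%:R^-1%:E.
  have cF : mu.-caratheodory F.
    by apply: caratheodory_measurable_setD => //; exact: internal_caratheodory.
  (* Splitting [internal (D n)] along [F] and cancelling the finite [mu F] bounds the excess of
     [D n] over [F], which contains [E] minus [A n]. *)
  have [_ FD] := DP n; rewrite -mui// (cF (internal (D n))) (setIidr FD).
  rewrite leeD2lE// => H.
  apply: le_trans H; apply: le_outer_measure => z [Ez nAz]; split.
    apply: contrapT => nDz; apply: nAz; rewrite internal_setD; split=> //.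
    exact: EC.
  by move=> [].
have AS n : family_mass w m (fun i => \bigcup_(k < n) A k i) <= mu E.
  rewrite -mui; last by move=> i; apply: Ball_bigcup => // k _; exact: mA.
  apply: le_outer_measure => z Az.
  have [k] : exists k : 'I_n, internal (A k) z.
    apply: (internal_bigcup (A := fun k : 'I_n => A k)).
    by apply: filterS Az => i [k /= kn Ak]; exists (Ordinal kn).
  exact: AE.
have [B [mB AB BE]] := internal_saturation w_nonprincipal mA AS.
have EB : mu (E `\` internal B) = 0.
  apply/eqP; rewrite eq_le outer_measure_ge0 andbT.
  apply/lee_addgt0Pr => e e0; have [n] := ltr_add_invr e0; rewrite !add0r => ne.
  apply: (@le_trans _ _ n.+1%:R^-1%:E); last by rewrite lee_fin ltW.
  apply: le_trans (EA n); apply: le_outer_measure; apply: setDS; exact: AB.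
have BE0 : mu (internal B `\` E) = 0.
  have := cE (internal B); rewrite mui// => BE'; move: BE; rewrite BE'.
  (* As [B] misses only a null part of [E], it has no mass left outside [E]. *)
  have -> : mu (internal B `&` E) = mu E.
    have := internal_caratheodory w_nonprincipal m mB E.
    by rewrite -setDE EB adde0 setIC => <-.
  rewrite -[leRHS]adde0 leeD2lE// => H; apply/eqP.
  by rewrite eq_le outer_measure_ge0 andbT.
exists B => //; apply/eqP; rewrite eq_le outer_measure_ge0 andbT.
by apply: le_trans (outer_measureU2 _ _ _) _; rewrite EB BE0 adde0.
Qed.

Lemma caratheodory_truncations (A : set (finpart w X)) (r : R) :
  mu.-caratheodory A -> truncations m A r !=set0.
Proof.
move=> cA; have mb := ball_families_ball (fun=> point) r.
have [||||B mB B0] := @caratheodory_internal_ae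
  (A `&` internal (fun=> ball point r)) (fun=> ball point r) => //.
- apply: caratheodory_measurable_setI => //.
  exact: internal_caratheodory.
- exact: family_mass_ball_fin.
- by exists (internal B); split; [exists B|exact: outer_null].
Qed.

Lemma bigcup_internal_ball :
  \bigcup_n internal (fun=> ball point n%:R) = [set: finpart w X].
Proof.
apply/seteqP; split=> // z _.
have zfin := udist_fin (ubase w X) z.
exists (Num.truncn (fine (udist (val (ubase w X)) (val z)))).+1 => //.
apply: internal_ball_lt; rewrite -[X in X < _](fineK zfin) lte_fin.
exact: truncnS_gt.
Qed.

(** Truncation at [r] yields the measure of the part of [A] in the ball of radius [r]; continuity
    from below along integer radii recovers [mu A]. *)
Lemma loeb_massE (A : set (finpart w X)) :
  mu.-caratheodory A -> loeb_mass m A = mu A.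
Proof.
move=> cA.
pose f (r : R) := mu (A `&` internal (fun=> ball point r)).
have f_nd : nondecreasing_fun f.
  move=> r s rs; apply: le_outer_measure; apply: setIS => z.
  by apply: filterS => i; exact: le_ball.
have truncE r : internal_mass m (get (truncations m A r)) = f r.
  by apply: truncations_mass; apply: getPex; exact: caratheodory_truncations.
rewrite /loeb_mass; under eq_fun do rewrite truncE.
apply/cvg_lim => //.
have -> : mu A = ereal_sup (range f); last exact: nondecreasing_cvge.
apply/eqP; rewrite eq_le; apply/andP; split; last first.
  by apply: ge_ereal_sup => _ [r _ <-]; apply: le_outer_measure; exact: subIsetl.
have : mu (A `&` internal (fun=> ball point n%:R)) @[n --> \oo] --> mu A.
  rewrite -[in X in _ --> X](setIT A) -bigcup_internal_ball setI_bigcupr.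
  apply: (@nondecreasing_cvg_mu _ (caratheodory_type mu)).
  - move=> n; apply: caratheodory_measurable_setI => //.
    by apply: internal_caratheodory => i; exact: Ball_ball.
  - apply: bigcupT_measurable => n; apply: caratheodory_measurable_setI => //.
    by apply: internal_caratheodory => i; exact: Ball_ball.
  - move=> a b ab; apply/subsetPset; apply: setIS => z.
    by apply: filterS => i; apply: le_ball; rewrite ler_nat.
move=> fA; rewrite -(cvg_lim _ fA)//; apply: lime_le; first exact: cvgP fA.
by apply: nearW => n; apply: ereal_sup_ubound; exists n%:R.
Qed.

Lemma ulim_massE (A : set (ultralimit w X)) :
  Ball A -> ulim_mass w m A = ultralimit_measure A.
Proof.
move=> mA; apply: loeb_massE; rewrite -[X in _ X]setTI.
exact: measurable_uproj.
Qed.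

Lemma ultralimit_measure_ball_fin (r : R) :
  ultralimit_measure (ball point r) < +oo.
Proof.
apply: le_lt_trans (family_mass_ball_fin r).
apply: internal_outer_le; first exact: (ball_families_ball (fun=> point)).
by move=> z /ball_uproj; exact: internal_ball_lt.
Qed.

Lemma spt_ulim_mass : spt (ulim_mass w m) = spt ultralimit_measure.
Proof.
apply/seteqP; split=> a sa r /sa; rewrite ulim_massE//; exact: Ball_ball.
Qed.

Lemma concentrated_ulim_mass (A : set (ultralimit w X)) :
  concentrated (ulim_mass w m) A <-> concentrated ultralimit_measure A.
Proof.
by split=> -[mA A0]; split; move: A0; rewrite ?ulim_massE//; exact: BallC.
Qed.

(** * Total boundedness of the limit against that of the sequence *)

Lemma Ball_cballD_bigcup (I : finType) (Y : pmetricType R) (x : I -> Y) (a : Y)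
    (s r : R) : Ball (cball a s `\` \bigcup_n ball (x n) r).
Proof.
by apply: BallD; [exact: Ball_cball|exact: Ball_bigcup_ball].
Qed.

Lemma totally_bounded_ulim_mass :
  boundedly_totally_bounded (ulim_mass w m) <->
  boundedly_totally_bounded ultralimit_measure.
Proof.
split=> tb r0 r e r00 r_gt0 e0; have [M [x xM]] := tb r0 r e r00 r_gt0 e0;
  exists M, x; move: xM; rewrite ulim_massE//; exact: Ball_cballD_bigcup.
Qed.

Lemma totally_bounded_asymptotically :
  boundedly_totally_bounded ultralimit_measure ->
  asymptotically_boundedly_totally_bounded w m.
Proof.
move=> tb r0 r e r00 r_gt0 e0; have [M [x xM]] := tb r0 r e r00 r_gt0 e0.
exists M, (fun i n => repr (val (repr (x n))) i).
pose A i := cball point r0 `\` \bigcup_n ball (repr (val (repr (x n))) i) r.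
have mA : ball_families A by move=> i; exact: Ball_cballD_bigcup.
(* [A i] lies in the closed ball of radius [r0], so truncating at [r0 + 1] removes nothing. *)
apply: le_trans xM; apply: (@le_trans _ _ (truncated_mass w m A (r0 + 1))).
  apply: le_ulim; apply: nearW => i; rewrite setIidl// => y [/= y0 _].
  by rewrite ballEmdist/= (le_lt_trans y0)// ltrDl.
apply: le_trans (truncated_mass_le _ _ mA) _; rewrite -(internal_outerE m mA).
apply: le_internal_outer; rewrite internal_setD => z [z0 nz]; split.
  have := internal_cball (x := fun=> point) z0.
  by rewrite -[uclass _ _]/(val (ubase w X)) -mdist_uproj lee_fin.
move=> [n _]; rewrite -(uprojK (x n)) => /ball_uproj.
rewrite -(uclass_repr (val (repr (x n)))) => /internal_ball_lt xz; apply: nz.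
by apply: filterS xz => i xz; exists n.
Qed.

Lemma asymptotically_totally_bounded :
  asymptotically_boundedly_totally_bounded w m ->
  boundedly_totally_bounded ultralimit_measure.
Proof.
move=> tb r0 r e r00 r_gt0 e0.
(* The larger ball and the smaller mesh absorb the passage between strict and weak inequalities. *)
have [||M [x xM]] := tb (r0 + 1)%R (r / 2)%R e _ _ e0.
- by rewrite addr_gt0.
- by rewrite divr_gt0.
(* Centres at infinite distance define no point of the limit and are replaced by the base point. *)
pose y (n : 'I_M) : @ultralimit R w U X :=
  if pselect (udist (uclass w (x^~ n)) (uclass w (fun=> point)) < +oo)
  is left h then uproj (exist _ (uclass w (x^~ n)) h) else point.
exists M, y; apply: le_trans xM.
pose A i := cball point (r0 + 1) `\` \bigcup_n ball (x i n) (r / 2).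
have mA : ball_families A by move=> i; exact: Ball_cballD_bigcup.
apply: (@le_trans _ _ (family_mass w m A)); last first.
  apply: family_mass_le => // s; apply: le_ulim; apply: nearW => i.
  apply: le_mass; [|exact: mA|exact: subIsetl].
  by apply: BallI; [exact: mA|exact: Ball_ball].
apply: internal_outer_le => // z [/= z0 nz]; rewrite internal_setD; split.
  apply: filterS (internal_ball_lt (x := fun=> point) (r := (r0 + 1)%R) _).
    by move=> i; rewrite ballEmdist; exact: ltW.
  rewrite -[uclass _ _]/(val (ubase w X)) -mdist_uproj lte_fin.
  by rewrite (le_lt_trans z0)// ltrDl.
move=> /(internal_bigcup (A := fun n i => ball (x i n) (r / 2)))[n].
move=> /(internal_ball_le (x := x^~ n)) xz; apply: nz; exists n => //.
rewrite /y; case: pselect => [h|[]].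
  apply/ball_uproj; apply: le_lt_trans xz _.
  by rewrite lte_fin ltr_pdivrMr// ltr_pMr// ltr1n.
(* A centre within [r / 2] of the finite point [z] is itself at finite distance, so the replaced
   centres cover nothing. *)
apply: le_lt_trans (udist_triangle (val z) _ _) _.
rewrite lte_add_pinfty// ?(valP z)//; apply: le_lt_trans xz _; exact: ltry.
Qed.

End ultralimit_measure.

Theorem theorem8p3 (R : realType) (w : set_system nat) (U : UltraFilter w)
    (w_nonprincipal : forall n : nat, w <> principal_filter n)
    (X : nat -> pmetricType R)
    (m : forall i : nat, {measure set (ballType (X i)) -> \bar R})
    (m_ubf : unif_boundedly_finite w m) :
  [<-> concentrated (ulim_mass w m) (spt (ulim_mass w m));
       exists C : set (ultralimit w X),
         [/\ closed C, separable C & concentrated (ulim_mass w m) C];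
       boundedly_totally_bounded (ulim_mass w m);
       asymptotically_boundedly_totally_bounded w m].
Proof.
have fin := @ultralimit_measure_ball_fin R w U w_nonprincipal X m m_ubf.
tfae.
- move=> sptC; exists (spt (ulim_mass w m)); split=> //.
    by rewrite (spt_ulim_mass w_nonprincipal)//; exact: spt_closed.
  by rewrite (spt_ulim_mass w_nonprincipal)//; exact: (spt_separable fin).
- move=> [C [_ sC /(concentrated_ulim_mass w_nonprincipal m_ubf) cC]].
  apply/(totally_bounded_ulim_mass w_nonprincipal m_ubf).
  exact: (concentrated_separable_totally_bounded fin sC cC).
- move=> /(totally_bounded_ulim_mass w_nonprincipal m_ubf).
  exact: totally_bounded_asymptotically.
- move=> /(asymptotically_totally_bounded w_nonprincipal).
  move=> /totally_bounded_concentrated cC.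
  rewrite (spt_ulim_mass w_nonprincipal)//.
  exact/(concentrated_ulim_mass w_nonprincipal m_ubf).
Qed.
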